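(* There exists an absolute constant $C>0$ such that for all $n\ge 1$ and all non-constant $f:\{-1,1\}^n\to\{-1,1\}$, $$\mathbb{E}\sqrt{h_f}\;\ge\; C\cdot \mathrm{Var}(f)\cdot\sqrt{\log\left(2+\frac{e}{\sum_{i=1}^n \mathrm{Inf}_i(f)^2}\right)}.$$
   Context: $\mu$ is the uniform probability measure on $\{-1,1\}^n$; $\mathbb{E}$ and $\mathrm{Var}$ are taken with respect to $\mu$. For $y\in\{-1,1\}^n$, $y^{\oplus i}$ is $y$ with the $i$-th coordinate flipped. The influence is $\mathrm{Inf}_i(f)=\mu(\{y: f(y)\ne f(y^{\oplus i})\})$, and the sensitivity of $f$ at $y$ is $h_f(y)=\#\{i\in\{1,\dots,n\}: f(y)\neq f(y^{\oplus i})\}$. $\log$ is the natural logarithm. *)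

(* Defs.v *)
From mathcomp Require Import all_boot all_order all_algebra.
From mathcomp Require Import reals.

Set Implicit Arguments.
Unset Strict Implicit.
Unset Printing Implicit Defensive.

Import GRing.Theory.
Local Open Scope ring_scope.

(* The two-point set {-1,1} is encoded by bool: b stands for (-1)^b, i.e.     *)
(* false for 1 and true for -1, so that negation of booleans is the change of *)
(* sign. Real-valued quantities such as the variance of a function f from the *)
(* cube to {-1,1} are computed on the values (-1)^b, through signR.           *)
Definition sign := bool.

Definition signR (R : realType) (b : sign) : R := (-1) ^+ b.

Definition cube (n : nat) := {ffun 'I_n -> sign}.

Definition flip (n : nat) (y : cube n) (i : 'I_n) : cube n :=
  [ffun j => if j == i then ~~ y j else y j].

Definition mu (R : realType) (n : nat) (A : {set cube n}) : R :=
  #|A|%:R / #|{: cube n}|%:R.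

Definition expect (R : realType) (n : nat) (X : cube n -> R) : R :=
  \sum_(y : cube n) X y * mu R [set y].

Definition variance (R : realType) (n : nat) (X : cube n -> R) : R :=
  expect (fun y => (X y - expect X) ^+ 2).

Definition influence (R : realType) (n : nat) (f : cube n -> sign)
    (i : 'I_n) : R :=
  mu R [set y | f y != f (flip y i)].

Definition sensitivity (n : nat) (f : cube n -> sign) (y : cube n) : nat :=
  #|[set i : 'I_n | f y != f (flip y i)]|.

(* Main.v *)
Require Import Defs.
From mathcomp Require Import all_boot all_order all_algebra.
From mathcomp Require Import reals sequences exp.
From mathcomp Require Import ring lra zify.

Set Implicit Arguments.
Unset Strict Implicit.
Unset Printing Implicit Defensive.

Import Order.TTheory GRing.Theory Num.Theory.

Local Open Scope ring_scope.

(** The proof compares the Fourier weights a_S^2 of the sign-valued function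
    F = (-1)^f at high and at low degree, where a_S is the coefficient of F on
    the character chi S. Write h for the sensitivity, V for the variance and M
    for the sum of the squared influences.

    High degree. For a set J of coordinates, freeze the coordinates outside J to
    those of a point x and let u_j(x) be the degree-one Fourier coefficient at
    j in J of the remaining function. By Bessel the vector (u_j(x))_j has norm
    at most 1, so pairing it with the discrete gradient of F over J gives
      E sqrt (number of sensitive coordinates in J)
        >= E sum_j u_j^2 = sum of a_S^2 over the S meeting J in one point
    ([expect_sqrt_pivotal_ge]). If J is random of density p, the left side is
    on average at most sqrt p * E sqrt h by concavity, while for p of order 1/d
    a set S of size about d meets J in one point with constant probability.
    This gives E sqrt h >= c sqrt d * (weight on degrees in [d, 4d)). The
    windows [d 4^k, d 4^(k+1)) sum up geometrically, so E sqrt h >= c sqrt d *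
    (weight on degrees >= d) ([high_degree]). With d = 1 this is already
    E sqrt h >= c V.

    Low degree. It remains to see that at most half of the variance lies on
    degrees 1, ..., D when D is a small multiple of log (1 / M)
    ([low_weight_half]); both arguments rest on Bonami's hypercontractive
    inequality [bonami].
    If V is at most c^D, then F is, up to a constant, supported on a set of
    measure at most V, and hypercontractivity bounds the low-degree weight by
    C^D V^(3/2) ([low_weight_variance]), which is at most V / 2 for c small.
    If V is larger, a bound of the low-degree weight by C^D (s M + 1 / s), for
    all s > 0, is enough. A uniformly random J meets each S of size in [1, D] in one point with
    probability at least 2^-D, so it suffices to bound the sum over j in J of
    b_j = E u_j g_j, where g_j is the part of u_j coming from the sets of size
    at most D. Here E |u_j| <= Inf_j and sum_j u_j^2 <= 1, while g_j has low
    degree, hence light tails. Cutting g_j at the height sqrt (s b_j), the part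
    below contributes at most sqrt (s b_j) Inf_j, and the part above is
    controlled by the fourth moment of g_j and by Bessel
    ([unit_weight_influence]).

    Taking D maximal in the second step and d = D + 1 in the first one, sqrt d
    is comparable with the square root of the logarithm in the theorem. *)

(** * Expectation on the cube *)

Section Expectation.
Variables (R : realType) (n : nat).
Implicit Types (X Y : cube n -> R) (c : R).

Lemma expectE X : expect X = (2 ^+ n)^-1 * \sum_y X y.
Proof.
rewrite /expect /mu mulr_sumr; apply: eq_bigr => y _.
by rewrite cards1 card_ffun card_bool card_ord natrX mul1r mulrC.
Qed.

Lemma eq_expect X Y : X =1 Y -> expect X = expect Y.
Proof. by move=> XY; rewrite !expectE (eq_bigr Y). Qed.

Lemma expectD X Y : expect (fun y => X y + Y y) = expect X + expect Y.
Proof. by rewrite !expectE big_split mulrDr. Qed.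

Lemma expectZ c X : expect (fun y => c * X y) = c * expect X.
Proof. by rewrite !expectE -mulr_sumr mulrCA. Qed.

Lemma expectZr c X : expect (fun y => X y * c) = expect X * c.
Proof. by rewrite mulrC -expectZ; apply: eq_expect => y; rewrite mulrC. Qed.

Lemma expectN X : expect (fun y => - X y) = - expect X.
Proof. by rewrite -mulN1r -expectZ; apply: eq_expect => y; rewrite mulN1r. Qed.

Lemma expectB X Y : expect (fun y => X y - Y y) = expect X - expect Y.
Proof. by rewrite expectD expectN. Qed.

Lemma expect_cst c : expect (fun _ : cube n => c) = c.
Proof.
rewrite expectE sumr_const card_ffun card_bool card_ord -[c *+ _]mulr_natl mulrA natrX.
by rewrite mulVf ?mul1r // expf_neq0 // pnatr_eq0.
Qed.

Lemma expect_sum (I : finType) (P : pred I) (F : I -> cube n -> R) :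
  expect (fun y => \sum_(i | P i) F i y) = \sum_(i | P i) expect (F i).
Proof.
rewrite expectE exchange_big mulr_sumr.
by apply: eq_bigr => i _; rewrite expectE.
Qed.

Lemma ler_expect X Y : (forall y, X y <= Y y) -> expect X <= expect Y.
Proof.
move=> XY; rewrite !expectE ler_wpM2l ?invr_ge0 ?exprn_ge0 //.
exact: ler_sum.
Qed.

Lemma expect_ge0 X : (forall y, 0 <= X y) -> 0 <= expect X.
Proof. by move=> X0; rewrite -(expect_cst 0); apply: ler_expect. Qed.

Lemma mu_expect (A : {set cube n}) : mu R A = expect (fun y => (y \in A)%:R).
Proof.
rewrite expectE /mu card_ffun card_bool card_ord natrX mulrC; congr (_ * _).
by rewrite -sum1_card natr_sum big_mkcond; apply: eq_bigr => y _; case: ifP.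
Qed.

Lemma expect_normE X : `|expect X| <= expect (fun y => `|X y|).
Proof.
rewrite ler_norml -expectN; apply/andP; split; apply: ler_expect => y.
  by rewrite lerNl -normrN ler_norm.
exact: ler_norm.
Qed.

(** Cauchy-Schwarz, from the nonnegativity of the quadratic form
    E (s X + t Y)^2 in s and t. *)
Lemma expect_CS X Y :
  expect (fun y => X y * Y y) ^+ 2 <=
  expect (fun y => X y ^+ 2) * expect (fun y => Y y ^+ 2).
Proof.
set a := expect (fun y => X y ^+ 2); set b := expect (fun y => Y y ^+ 2).
set c := expect _.
have quad s t : 0 <= s ^+ 2 * a + 2 * s * t * c + t ^+ 2 * b.
  rewrite -!expectZ -!expectD; apply: expect_ge0 => y.
  have -> : s ^+ 2 * X y ^+ 2 + 2 * s * t * (X y * Y y) + t ^+ 2 * Y y ^+ 2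
     = (s * X y + t * Y y) ^+ 2 by ring.
  exact: sqr_ge0.
have b0 : 0 <= b by apply: expect_ge0 => y; apply: sqr_ge0.
have a0 : 0 <= a by apply: expect_ge0 => y; apply: sqr_ge0.
have [b00|bn0] := eqVneq b 0; last first.
  have bp : 0 < b by rewrite lt_def bn0.
  have := quad b (- c).
  have -> : b ^+ 2 * a + 2 * b * - c * c + (- c) ^+ 2 * b = b * (a * b - c ^+ 2).
    by ring.
  by rewrite pmulr_rge0 // subr_ge0.
have [->|c0] := eqVneq c 0; first by rewrite expr0n mulr_ge0.
have := quad 1 (- (a + 1) / (2 * c)).
suff -> : 1 ^+ 2 * a + 2 * 1 * (- (a + 1) / (2 * c)) * c +
          (- (a + 1) / (2 * c)) ^+ 2 * b = -1 by rewrite oppr_ge0 ler10.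
by rewrite b00; field; rewrite c0.
Qed.
End Expectation.

(** * Fourier analysis on the cube *)

Section Fourier.
Variables (R : realType) (n : nat).
Implicit Types (X Y : cube n -> R) (S T J : {set 'I_n}) (x y : cube n).

Lemma signR_neg (b : sign) : signR R (~~ b) = - signR R b.
Proof. by rewrite /signR; case: b; rewrite /= ?expr1 ?expr0 ?opprK. Qed.

Lemma signRM (b : sign) : signR R b * signR R b = 1.
Proof. by rewrite /signR -expr2 sqrr_sign. Qed.

Lemma signR_sqr (b : sign) : signR R b ^+ 2 = 1.
Proof. by rewrite expr2 signRM. Qed.

Lemma flipK (i : 'I_n) : involutive (fun y : cube n => flip y i).
Proof.
by move=> y; apply/ffunP => j; rewrite !ffunE; case: eqP => // _; rewrite negbK.
Qed.

Lemma expect_flip (i : 'I_n) X : expect (fun y => X (flip y i)) = expect X.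
Proof.
rewrite !expectE; congr (_ * _).
by rewrite [RHS](reindex_inj (inv_inj (flipK i))).
Qed.

Definition chi S y : R := \prod_(i in S) signR R (y i).

Definition fourier X S : R := expect (fun y => X y * chi S y).

Lemma chi0 y : chi set0 y = 1.
Proof. by rewrite /chi big_set0. Qed.

Lemma chi1 (j : 'I_n) y : chi [set j] y = signR R (y j).
Proof. by rewrite /chi big_set1. Qed.

Lemma chi_sqr S y : chi S y * chi S y = 1.
Proof. by rewrite /chi -big_split big1 // => i _; apply: signRM. Qed.

Lemma chi_flip S (i : 'I_n) y :
  chi S (flip y i) = (if i \in S then -1 else 1) * chi S y.
Proof.
case: ifP => iS; rewrite /chi.
  rewrite !(big_setD1 i iS) /= !ffunE eqxx signR_neg mulrA mulN1r; congr (_ * _).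
  by apply: eq_bigr => j /setD1P[/negbTE ji _]; rewrite ffunE ji.
rewrite mul1r; apply: eq_bigr => j jS; rewrite ffunE; case: eqP => // ji.
by rewrite -ji jS in iS.
Qed.

Lemma expect_odd (i : 'I_n) X :
  (forall y, X (flip y i) = - X y) -> expect X = 0.
Proof.
move=> oddX; have := expect_flip i X.
rewrite (eq_expect oddX) expectN => /eqP; rewrite eqNr.
by move/eqP.
Qed.

Lemma expect_chiM S T : expect (fun y => chi S y * chi T y) = (S == T)%:R.
Proof.
have [->|ST] := eqVneq S T.
  by rewrite -[RHS](@expect_cst R n); apply: eq_expect => y; apply: chi_sqr.
suff [i iST] : exists i, (i \in S) != (i \in T).
  apply: (@expect_odd i) => y; rewrite !chi_flip.
  by move: iST; do 2!case: ifP => _ //; rewrite ?mulN1r ?mul1r ?mulrN ?mulNr.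
apply/existsP; apply: contraNT ST => /existsPn eST.
by apply/eqP/setP => i; apply/eqP; rewrite -[_ == _]negbK eST.
Qed.

Lemma expect_chi S : expect (chi S) = (S == set0)%:R.
Proof.
by rewrite -expect_chiM; apply: eq_expect => y; rewrite chi0 mulr1.
Qed.

(** The kernel of the inversion formula factors as the product over i of
    1 + x_i y_i, which vanishes as soon as some coordinate differs. *)
Lemma chi_kernel x y : \sum_S chi S x * chi S y = 2 ^+ n * (x == y)%:R.
Proof.
transitivity (\prod_(i < n) (signR R (x i) * signR R (y i) + 1)).
  rewrite bigA_distr; apply: eq_bigr => S _.
  by rewrite /chi -big_split [LHS]big_mkcond.
have [<-|xy] := eqVneq x y.
  rewrite mulr1 (eq_bigr (fun=> 2)) ?prodr_const ?card_ord // => i _.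
  by rewrite signRM.
have [i xyi] : exists i, x i != y i.
  apply/existsP; apply: contraNT xy => /existsPn exy.
  by apply/eqP/ffunP => i; apply/eqP; rewrite -[_ == _]negbK exy.
rewrite (bigD1 i) //= mulr0; suff -> : signR R (x i) * signR R (y i) + 1 = 0.
  by rewrite mul0r.
by move: xyi; rewrite /signR; case: (x i); case: (y i) => //= _; ring.
Qed.

Lemma fourier_inv X x : X x = \sum_S fourier X S * chi S x.
Proof.
transitivity (expect (fun y => X y * \sum_S chi S y * chi S x)).
  rewrite expectE (bigD1 x) //= chi_kernel eqxx mulr1 big1 ?addr0.
    by rewrite mulrCA mulVf ?mulr1 // expf_neq0 // pnatr_eq0.
  by move=> y /negbTE yx; rewrite chi_kernel yx !mulr0.
under eq_expect do rewrite mulr_sumr.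
rewrite expect_sum; apply: eq_bigr => S _; rewrite /fourier -expectZr.
by apply: eq_expect => y; rewrite mulrA.
Qed.

Lemma expect_chi_sumM (P Q : pred {set 'I_n}) (a b : {set 'I_n} -> R) :
  expect (fun y => (\sum_(S | P S) a S * chi S y) * (\sum_(S | Q S) b S * chi S y))
  = \sum_(S | P S && Q S) a S * b S.
Proof.
under eq_expect do rewrite mulr_suml.
rewrite expect_sum big_mkcondr; apply: eq_bigr => S _.
under eq_expect do rewrite mulr_sumr.
rewrite expect_sum; transitivity (\sum_(T | Q T) a S * b T * (S == T)%:R).
  apply: eq_bigr => T _; rewrite -expect_chiM -expectZ.
  by apply: eq_expect => y; ring.
rewrite big_mkcond (bigD1 S) //= eqxx mulr1 big1 ?addr0 //.
by move=> T TS; rewrite eq_sym (negbTE TS) mulr0 if_same.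
Qed.

Lemma expect_chi_sum_sqr (P : pred {set 'I_n}) (a : {set 'I_n} -> R) :
  expect (fun y => (\sum_(S | P S) a S * chi S y) ^+ 2) = \sum_(S | P S) a S ^+ 2.
Proof.
under eq_expect do rewrite expr2.
by rewrite expect_chi_sumM; apply: eq_big => S; rewrite ?andbb ?expr2.
Qed.

Lemma expectM_chi_sum X (P : pred {set 'I_n}) (a : {set 'I_n} -> R) :
  expect (fun y => X y * \sum_(S | P S) a S * chi S y) =
  \sum_(S | P S) a S * fourier X S.
Proof.
under eq_expect do rewrite mulr_sumr.
rewrite expect_sum; apply: eq_bigr => S _; rewrite -expectZ.
by apply: eq_expect => y; ring.
Qed.

Lemma parseval X : \sum_S fourier X S ^+ 2 = expect (fun y => X y ^+ 2).
Proof.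
by rewrite -expect_chi_sum_sqr; apply: eq_expect => y; rewrite [X y]fourier_inv.
Qed.

Lemma varianceE X : variance X = expect (fun y => X y ^+ 2) - expect X ^+ 2.
Proof.
rewrite /variance; set m := expect X.
transitivity (expect (fun y => X y ^+ 2 - 2 * m * X y + m ^+ 2)).
  by apply: eq_expect => y; ring.
by rewrite expectD expectB expectZ expect_cst -/m; ring.
Qed.

Lemma variance_fourier X :
  variance X = \sum_(S | S != set0) fourier X S ^+ 2.
Proof.
rewrite varianceE -parseval (bigD1 set0) //= addrAC.
have -> : fourier X set0 = expect X.
  by apply: eq_expect => y; rewrite chi0 mulr1.
by rewrite subrr add0r.
Qed.

End Fourier.

(** * Freezing coordinates *)

Section Restriction.
Variables (R : realType) (n : nat).
Implicit Types (X Y : cube n -> R) (S T J : {set 'I_n}) (x y : cube n).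

Definition mix J x y : cube n := [ffun i => if i \in J then y i else x i].

Lemma chi_mix S J x y :
  chi R S (mix J x y) = chi R (S :\: J) x * chi R (S :&: J) y.
Proof.
rewrite /chi (big_setID J) /= mulrC; congr (_ * _); apply: eq_bigr => i.
  by rewrite ffunE => /setDP[_ /negbTE->].
by rewrite ffunE => /setIP[_ ->].
Qed.

Lemma expect_mix J X :
  expect (fun x => expect (fun y => X (mix J x y))) = expect X.
Proof.
have mixE x y : X (mix J x y) =
    \sum_S fourier X S * (chi R (S :\: J) x * chi R (S :&: J) y).
  by rewrite fourier_inv; apply: eq_bigr => S _; rewrite chi_mix.
transitivity (\sum_S fourier X S * (S == set0)%:R); last first.
  under [RHS]eq_expect do rewrite fourier_inv.
  rewrite expect_sum; apply: eq_bigr => S _.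
  by rewrite expectZ expect_chi.
transitivity (expect (fun x => \sum_S fourier X S *
    (chi R (S :\: J) x * (S :&: J == set0)%:R))).
  apply: eq_expect => x; under eq_expect do rewrite mixE.
  rewrite expect_sum; apply: eq_bigr => S _.
  by rewrite expectZ expectZ expect_chi.
rewrite expect_sum; apply: eq_bigr => S _; rewrite expectZ expectZr expect_chi.
by rewrite -natrM mulnb -setU_eq0 setUC setID.
Qed.

(** The degree-one coefficient at j of the function that remains on the
    coordinates in J when those outside J are frozen to the values of x. *)
Definition rcoef J X (j : 'I_n) x : R :=
  expect (fun y => X (mix J x y) * signR R (y j)).

Lemma rcoefE J X j x :
  rcoef J X j x = \sum_(S | S :&: J == [set j]) fourier X S * chi R (S :\: J) x.
Proof.
rewrite /rcoef; under eq_expect do rewrite fourier_inv mulr_suml.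
rewrite expect_sum [RHS]big_mkcond; apply: eq_bigr => S _.
transitivity (fourier X S * chi R (S :\: J) x * (S :&: J == [set j])%:R).
  rewrite -expect_chiM -expectZ; apply: eq_expect => y.
  by rewrite chi_mix chi1; ring.
by case: ifP; rewrite ?mulr1 ?mulr0.
Qed.

Lemma rcoef_flip J X (j : 'I_n) x :
  j \in J -> rcoef J X j (flip x j) = rcoef J X j x.
Proof.
move=> jJ; apply: eq_expect => y; congr (X _ * _); apply/ffunP => i.
by rewrite !ffunE; case: ifP => // iJ; case: eqP => // ij; rewrite ij jJ in iJ.
Qed.

Lemma expect_sign2 (i j : 'I_n) :
  expect (fun y => signR R (y i) * signR R (y j)) = (i == j)%:R.
Proof.
under eq_expect do rewrite -!chi1.
by rewrite expect_chiM (inj_eq set1_inj).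
Qed.

(** Bessel's inequality for the restricted function, from
    E_y (X (mix J x y) - sum_j u_j y_j)^2 >= 0. *)
Lemma rcoef_bessel J X x : (forall y, X y ^+ 2 = 1) ->
  \sum_(j in J) rcoef J X j x ^+ 2 <= 1.
Proof.
move=> X1; set B := \sum_(j in J) _.
pose L y := \sum_(j in J) rcoef J X j x * signR R (y j).
have XL : expect (fun y => X (mix J x y) * L y) = B.
  under eq_expect do rewrite mulr_sumr.
  rewrite expect_sum; apply: eq_bigr => j _; rewrite expr2 -expectZ.
  by apply: eq_expect => y; ring.
have LL : expect (fun y => L y ^+ 2) = B.
  under eq_expect do rewrite expr2 mulr_suml.
  rewrite expect_sum; apply: eq_bigr => j jJ.
  under eq_expect do rewrite mulr_sumr.
  transitivity (\sum_(i in J) rcoef J X j x * rcoef J X i x * (j == i)%:R).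
    rewrite expect_sum; apply: eq_bigr => i _; rewrite -expect_sign2 -expectZ.
    by apply: eq_expect => y; ring.
  rewrite (bigD1 j) //= eqxx mulr1 big1 ?addr0 ?expr2 //.
  by move=> i /andP[_ /negbTE ij]; rewrite eq_sym ij mulr0.
rewrite -subr_ge0; have -> : 1 - B = expect (fun y => (X (mix J x y) - L y) ^+ 2).
  transitivity (expect (fun y => 1 + (-2) * (X (mix J x y) * L y) + L y ^+ 2)).
    by rewrite !expectD expectZ expect_cst XL LL; ring.
  by apply: eq_expect => y; rewrite sqrrB X1; ring.
by apply: expect_ge0 => y; apply: sqr_ge0.
Qed.

End Restriction.

Section Boolean.
Variables (R : realType) (n : nat) (f : cube n -> sign).
Implicit Types (S T J : {set 'I_n}) (x y : cube n).

Local Notation F := (fun y : cube n => signR R (f y)).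
Local Notation a := (fourier F).
Local Notation u J j := (rcoef J F j).

Definition diff (i : 'I_n) y : R := (signR R (f y) - signR R (f (flip y i))) / 2.

Lemma diff_norm i y : `|diff i y| = (f y != f (flip y i))%:R.
Proof.
rewrite /diff /signR; case: (f y); case: (f _) => //=; rewrite ?subrr ?mul0r ?normr0 //.
  by rewrite -opprD mulNr normrN -[1 + 1]/(2%:R) divff ?normr1 // pnatr_eq0.
by rewrite opprK -[1 + 1]/(2%:R) divff ?normr1 // pnatr_eq0.
Qed.

Lemma diff_sqr i y : diff i y ^+ 2 = (f y != f (flip y i))%:R.
Proof.
rewrite -real_normK ?num_real // diff_norm.
by case: (_ != _); rewrite ?expr1n ?expr0n.
Qed.

(** Symmetrizing under the flip of coordinate i replaces F by its discrete
    derivative, against any weight that is odd in that coordinate. *)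
Lemma expect_diff i (X : cube n -> R) : (forall y, X (flip y i) = - X y) ->
  expect (fun y => signR R (f y) * X y) = expect (fun y => diff i y * X y).
Proof.
move=> oddX; set e := LHS.
have e2 : expect (fun y => signR R (f (flip y i)) * X y) = - e.
  rewrite -expectN -(expect_flip i); apply: eq_expect => y.
  by rewrite flipK oddX mulrN.
transitivity ((e - - e) / 2); first by field.
rewrite -e2 -expectB -expectZr; apply: eq_expect => y; rewrite /diff; ring.
Qed.

Lemma influence_expect i : influence R f i = expect (fun y => `|diff i y|).
Proof.
rewrite /influence mu_expect; apply: eq_expect => y.
by rewrite diff_norm inE.
Qed.

(** Conditioning on the coordinates outside J does not increase the L1 norm of
    the discrete derivative. *)
Lemma rcoef_L1 J j : j \in J ->
  expect (fun x => `|u J j x|) <= influence R f j.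
Proof.
move=> jJ; rewrite influence_expect -(expect_mix J (fun y => `|diff j y|)).
apply: ler_expect => x /=.
have mix_flip y : mix J x (flip y j) = flip (mix J x y) j.
  apply/ffunP => i; rewrite !ffunE; case: ifP => // iJ.
  by case: eqP => // ij; rewrite ij jJ in iJ.
have -> : u J j x = expect (fun y => diff j (mix J x y) * signR R (y j)).
  set e := LHS.
  have e2 : expect (fun y => signR R (f (flip (mix J x y) j)) * signR R (y j)) = - e.
    rewrite -expectN -(expect_flip j); apply: eq_expect => y.
    by rewrite mix_flip flipK ffunE eqxx signR_neg mulrN.
  transitivity ((e - - e) / 2); first by field.
  rewrite -e2 -expectB -expectZr; apply: eq_expect => y; rewrite /diff; ring.
apply: le_trans (expect_normE _) _; apply: ler_expect => y.
by rewrite normrM /signR normr_sign mulr1.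
Qed.

(** The sum of w over the sets that meet J in exactly one point; for the squared
    Fourier coefficients this is the mean squared norm of the degree-one part
    of the function restricted to J. *)
Definition unit_weight J (w : {set 'I_n} -> R) : R :=
  \sum_(j in J) \sum_(S | S :&: J == [set j]) w S.

Definition pivotal y : {set 'I_n} := [set i | f y != f (flip y i)].

Lemma chi_rcoef J j x : j \in J ->
  signR R (x j) * u J j x = \sum_(S | S :&: J == [set j]) a S * chi R S x.
Proof.
move=> jJ; rewrite rcoefE mulr_sumr; apply: eq_bigr => S /eqP SJ.
rewrite mulrCA; congr (_ * _).
by rewrite -chi1 -SJ /chi -big_setID.
Qed.

(** Pair the discrete gradient over J with the degree-one part of the
    restriction to J, which is a vector of norm at most 1. *)
Lemma expect_sqrt_pivotal_ge J :
  unit_weight J (fun S => a S ^+ 2) <=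
  expect (fun y => Num.sqrt #|pivotal y :&: J|%:R).
Proof.
have -> : unit_weight J (fun S => a S ^+ 2) =
    expect (fun y => \sum_(j in J) diff j y * (signR R (y j) * u J j y)).
  rewrite expect_sum; apply: eq_bigr => j jJ.
  rewrite -expect_diff; last first.
    by move=> y; rewrite rcoef_flip // ffunE eqxx signR_neg mulNr.
  under eq_expect do rewrite chi_rcoef //.
  by rewrite expectM_chi_sum; apply: eq_bigr => S _; rewrite expr2.
apply: ler_expect => y.
have cardE : #|pivotal y :&: J|%:R = \sum_(j in J) diff j y ^+ 2.
  rewrite -sum1_card natr_sum big_mkcond [RHS]big_mkcond; apply: eq_bigr => j _.
  by rewrite !inE diff_sqr; case: (j \in J); case: (_ != _).
rewrite cardE; set A := \sum_(j in J) diff j y ^+ 2.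
have A0 : 0 <= A by apply: sumr_ge0 => j _; apply: sqr_ge0.
have bes : \sum_(j in J) u J j y ^+ 2 <= 1.
  by apply: rcoef_bessel => z; apply: signR_sqr.
have AE : Num.sqrt A ^+ 2 = A by rewrite sqr_sqrtr.
have [A00|An0] := eqVneq A 0.
  rewrite A00 sqrtr0 big1 // => j jJ.
  have : diff j y ^+ 2 == 0.
    move/eqP: A00; rewrite psumr_eq0 => [|i _]; last exact: sqr_ge0.
    by move=> /allP/(_ j); rewrite mem_index_enum jJ; apply.
  by rewrite sqrf_eq0 => /eqP->; rewrite mul0r.
have c0 : 0 < Num.sqrt A by rewrite sqrtr_gt0 lt_def An0.
set c := Num.sqrt A in AE c0 *.
(* Young's inequality d v <= d^2 / (2 c) + c v^2 / 2, with c the norm of d *)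
apply: (@le_trans _ _ (\sum_(j in J) (diff j y ^+ 2 / (2 * c) + c / 2 * u J j y ^+ 2))).
  apply: ler_sum => j _; rewrite -subr_ge0.
  have -> : diff j y ^+ 2 / (2 * c) + c / 2 * u J j y ^+ 2 -
      diff j y * (signR R (y j) * u J j y) =
      (diff j y - c * (signR R (y j) * u J j y)) ^+ 2 / (2 * c)
      + c / 2 * u J j y ^+ 2 * (1 - signR R (y j) ^+ 2).
    by field; rewrite gt_eqF.
  by rewrite signR_sqr subrr mulr0 addr0 divr_ge0 ?sqr_ge0 // mulr_ge0 // ltW.
rewrite big_split -mulr_suml -mulr_sumr -/A -AE /=.
apply: (@le_trans _ _ (c ^+ 2 / (2 * c) + c / 2 * 1)).
  by rewrite lerD2l ler_wpM2l // divr_ge0 // ltW.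
by rewrite le_eqVlt; apply/orP; left; apply/eqP; field; rewrite gt_eqF.
Qed.

End Boolean.

(** * Random sets of coordinates and high-degree weight *)

Section RandomSubset.
Variables (R : realType) (n : nat) (p : R).
Implicit Types (S J : {set 'I_n}).

Definition rset_prob J : R := \prod_(i < n) (if i \in J then p else 1 - p).

Lemma rset_prob_ge0 J : 0 <= p <= 1 -> 0 <= rset_prob J.
Proof.
by move=> /andP[p0 p1]; apply: prodr_ge0 => i _; case: ifP; rewrite ?subr_ge0.
Qed.

Lemma rset_prob_setI1 S (j : 'I_n) : j \in S ->
  \sum_(J | S :&: J == [set j]) rset_prob J = p * (1 - p) ^+ #|S|.-1.
Proof.
move=> jS.
(* the probability that J avoids S :\ j and contains j, as a product *)
pose F (i : 'I_n) := if (i \in S) && (i != j) then 0 else p.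
pose G (i : 'I_n) := if i == j then 0 else 1 - p.
transitivity (\prod_(i < n) (F i + G i)).
  rewrite bigA_distr big_mkcond; apply: eq_bigr => J _.
  case: eqP => [SJ|SJ].
    apply: eq_bigr => i _; rewrite /F /G; case: ifP => iJ.
      by case: ifP => // /andP[iS]; rewrite -in_set1 -SJ inE iS iJ.
    case: eqP => // ij; have : i \in S :&: J by rewrite SJ ij set11.
    by rewrite inE iJ andbF.
  apply/esym/eqP; rewrite prodf_seq_eq0.
  apply/hasP; have [jJ|jJ] := boolP (j \in J); last first.
    by exists j; rewrite ?mem_index_enum // (negbTE jJ) /G eqxx /=.
  have [i iSJ ij] : exists2 i, i \in S :&: J & i != j.
    apply/exists_inP; apply: contra_notT SJ => /exists_inPn h.
    apply/setP => i; rewrite in_set1; apply/idP/eqP => [/h|->].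
      by rewrite negbK => /eqP.
    by rewrite inE jS jJ.
  case/setIP: iSJ => iS iJ.
  by exists i; rewrite ?mem_index_enum // iJ /F iS ij /=.
rewrite (bigID (mem S)) /= [X in _ * X]big1 ?mulr1; last first.
  move=> i iS; rewrite /F /G (negbTE iS) /=.
  by case: eqP => [ij|_]; [rewrite ij jS in iS | ring].
rewrite (bigD1 j) //= /F /G eqxx andbF addr0; congr (_ * _).
transitivity (\prod_(i in S :\ j) (1 - p)); last first.
  by rewrite prodr_const (cardsD1 j S) jS.
apply: eq_big => [i|i /andP[-> ij]]; first by rewrite !inE andbC.
by rewrite ij (negbTE ij) add0r.
Qed.

Lemma rset_prob_sum1 : \sum_J rset_prob J = 1.
Proof.
by rewrite -bigA_distr big1 // => i _ /=; rewrite addrC subrK.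
Qed.

Lemma rset_prob_mem (j : 'I_n) : \sum_(J : {set 'I_n} | j \in J) rset_prob J = p.
Proof.
transitivity (\sum_(J | [set j] :&: J == [set j]) rset_prob J).
  by apply: eq_bigl => J; rewrite (sameP eqP setIidPl) sub1set.
by rewrite rset_prob_setI1 ?set11 // cards1 expr0 mulr1.
Qed.

Lemma rset_unit_weight (w : {set 'I_n} -> R) :
  \sum_J rset_prob J * unit_weight J w =
  \sum_S w S * (#|S|%:R * (p * (1 - p) ^+ #|S|.-1)).
Proof.
transitivity (\sum_(S : {set 'I_n}) \sum_(j in S)
    w S * \sum_(J | S :&: J == [set j]) rset_prob J).
  transitivity (\sum_(J : {set 'I_n}) \sum_(S : {set 'I_n}) \sum_(j in S)
      if S :&: J == [set j] then w S * rset_prob J else 0).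
    apply: eq_bigr => J _; rewrite /unit_weight.
    rewrite (eq_bigr (fun j => \sum_S if S :&: J == [set j] then w S else 0)).
      rewrite exchange_big mulr_sumr; apply: eq_bigr => S _ /=.
      rewrite mulr_sumr big_mkcond [RHS]big_mkcond; apply: eq_bigr => j _.
      case: eqP => [SJ|_]; last by rewrite mulr0 !if_same.
      have : j \in S :&: J by rewrite SJ set11.
      by rewrite inE => /andP[-> ->]; rewrite mulrC.
    by move=> j _; rewrite [LHS]big_mkcond.
  rewrite exchange_big; apply: eq_bigr => S _ /=.
  rewrite exchange_big; apply: eq_bigr => j _ /=.
  by rewrite -big_mkcond mulr_sumr.
apply: eq_bigr => S _.
rewrite (eq_bigr (fun=> w S * (p * (1 - p) ^+ #|S|.-1))); last first.
  by move=> j jS; rewrite rset_prob_setI1.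
by rewrite sumr_const -mulrnAr mulr_natl.
Qed.

(** By concavity of the square root, as p |T| is the mean of |T :&: J|. *)
Lemma rset_sqrt_card (T : {set 'I_n}) : 0 <= p <= 1 ->
  \sum_J rset_prob J * Num.sqrt #|T :&: J|%:R <= Num.sqrt p * Num.sqrt #|T|%:R.
Proof.
move=> p01; have [p0 p1] := andP p01.
have meanE : \sum_J rset_prob J * #|T :&: J|%:R = p * #|T|%:R.
  transitivity (\sum_(j in T) \sum_(J : {set 'I_n} | j \in J) rset_prob J).
    under [RHS]eq_bigr do rewrite big_mkcond.
    rewrite exchange_big; apply: eq_bigr => J _ /=.
    rewrite -sum1_card natr_sum mulr_sumr big_mkcond [RHS]big_mkcond.
    apply: eq_bigr => j _; rewrite inE; case: (j \in T) => //=.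
    by case: (j \in J); rewrite ?mulr1.
  rewrite (eq_bigr (fun=> p)) => [|j _]; last exact: rset_prob_mem.
  by rewrite sumr_const mulr_natr.
rewrite -sqrtrM // -meanE; set m := \sum_J _ * _%:R.
have m0 : 0 <= m.
  by apply: sumr_ge0 => J _; rewrite mulr_ge0 // rset_prob_ge0.
have mE : Num.sqrt m ^+ 2 = m by rewrite sqr_sqrtr.
have [m00|mn0] := eqVneq m 0.
  rewrite m00 sqrtr0 big1 // => J _.
  move/eqP: m00; rewrite psumr_eq0; last first.
    by move=> i _; rewrite mulr_ge0 // rset_prob_ge0.
  move=> /allP/(_ J (mem_index_enum _)) /=; rewrite mulf_eq0.
  by case/orP => /eqP->; rewrite ?mul0r // sqrtr0 mulr0.
have c0 : 0 < Num.sqrt m by rewrite sqrtr_gt0 lt_def mn0.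
set c := Num.sqrt m in mE c0 *.
apply: (@le_trans _ _ (\sum_J (rset_prob J * #|T :&: J|%:R / (2 * c)
    + rset_prob J * (c / 2)))).
  apply: ler_sum => J _; rewrite -mulrA -mulrDr ler_wpM2l ?rset_prob_ge0 //.
  rewrite -subr_ge0; set t : R := #|_|%:R.
  have tE : Num.sqrt t ^+ 2 = t by rewrite sqr_sqrtr.
  have -> : t / (2 * c) + c / 2 - Num.sqrt t = (Num.sqrt t - c) ^+ 2 / (2 * c).
    by rewrite -{1}tE; field; rewrite gt_eqF.
  by rewrite divr_ge0 ?sqr_ge0 // mulr_ge0 // ltW.
rewrite big_split -!mulr_suml /= rset_prob_sum1 -/m -mE.
by rewrite le_eqVlt; apply/orP; left; apply/eqP; field; rewrite gt_eqF.
Qed.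

End RandomSubset.

Section HighDegree.
Variables (R : realType) (n : nat) (f : cube n -> sign).
Implicit Types (S T J : {set 'I_n}) (x y : cube n).

Local Notation F := (fun y : cube n => signR R (f y)).
Local Notation a := (fourier F).
Local Notation Esqrt := (expect (fun y => Num.sqrt ((sensitivity f y)%:R : R))).

Lemma expect_sqrt_ge0 : 0 <= Esqrt.
Proof. by apply: expect_ge0 => y; apply: sqrtr_ge0. Qed.

(** Average the bound for a fixed J over a random J of density p. *)
Lemma random_restriction (p : R) : 0 <= p <= 1 ->
  \sum_S a S ^+ 2 * (#|S|%:R * (p * (1 - p) ^+ #|S|.-1)) <= Num.sqrt p * Esqrt.
Proof.
move=> p01; rewrite -rset_unit_weight -expectZ.
apply: (@le_trans _ _ (expect (fun y =>
    \sum_J rset_prob p J * Num.sqrt #|pivotal f y :&: J|%:R))).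
  rewrite expect_sum; apply: ler_sum => J _.
  by rewrite expectZ ler_wpM2l ?rset_prob_ge0 // expect_sqrt_pivotal_ge.
apply: ler_expect => y.
exact: rset_sqrt_card.
Qed.

Lemma bernoulli_ineq (p : R) m : 0 <= p <= 1 -> 1 - m%:R * p <= (1 - p) ^+ m.
Proof.
move=> /andP[p0 p1]; elim: m => [|m IH]; first by rewrite mul0r subr0 expr0.
rewrite exprS; apply: le_trans (ler_wpM2l _ IH); last by rewrite subr_ge0.
rewrite -subr_ge0.
have -> : (1 - p) * (1 - m%:R * p) - (1 - m.+1%:R * p) = m%:R * p ^+ 2.
  by rewrite -natr1; ring.
by rewrite mulr_ge0 // sqr_ge0.
Qed.

(** With p = 1 / (8 d), a random set of density p meets a set of size in
    [d, 4 d) in exactly one point with probability at least 1 / 16. *)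
Lemma window_weight d : (0 < d)%N ->
  Num.sqrt d%:R * \sum_(S : {set 'I_n} | (d <= #|S| < 4 * d)%N) a S ^+ 2 <= 8 * Esqrt.
Proof.
move=> d0; have dp : 0 < d%:R :> R by rewrite ltr0n.
set W := \sum_(S | _) _.
pose p : R := (8 * d%:R)^-1.
have p0 : 0 < p by rewrite invr_gt0 mulr_gt0.
have d1 : 1 <= d%:R :> R by rewrite ler1n.
have pd : p * d%:R = 1 / 8 by rewrite /p; field; rewrite gt_eqF.
have p1 : p <= 1.
  by rewrite invf_le1 ?mulr_gt0 //; lra.
have p01 : 0 <= p <= 1 by rewrite (ltW p0).
have W16 : W / 16 <= Num.sqrt p * Esqrt.
  apply: le_trans (random_restriction p01); rewrite /W mulr_suml big_mkcond.
  apply: ler_sum => S _; case: ifP => [/andP[dS S4d]|_]; last first.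
    rewrite mulr_ge0 ?sqr_ge0 // mulr_ge0 // mulr_ge0 // ?exprn_ge0 ?(ltW p0) //.
    by rewrite subr_ge0.
  rewrite ler_wpM2l ?sqr_ge0 //.
  have half : 1 / 2 <= (1 - p) ^+ #|S|.-1.
    apply: le_trans (bernoulli_ineq _ p01).
    have : #|S|.-1%:R * p <= (4 * d)%:R * p.
      rewrite ler_wpM2r ?(ltW p0) // ler_nat.
      by apply: leq_trans (leq_pred _) (ltnW S4d).
    rewrite natrM -mulrA [d%:R * p]mulrC pd; lra.
  apply: (@le_trans _ _ (d%:R * p * (1 / 2))).
    by rewrite [d%:R * p]mulrC pd; lra.
  rewrite mulrA ler_pM //.
  - by rewrite mulr_ge0 // ltW.
  - lra.
  - by rewrite ler_wpM2r ?(ltW p0) // ler_nat.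
have sp : Num.sqrt p * Num.sqrt d%:R <= 1 / 2.
  rewrite -sqrtrM ?(ltW p0) // pd.
  have -> : 1 / 2 = Num.sqrt (1 / 4) :> R.
    rewrite (_ : 1 / 4 = (1 / 2) ^+ 2); last by field.
    by rewrite sqrtr_sqr ger0_norm; lra.
  by rewrite ler_sqrt; lra.
have E0 := expect_sqrt_ge0.
have sd0 : 0 <= Num.sqrt d%:R :> R by apply: sqrtr_ge0.
have h1 := ler_wpM2l sd0 W16.
have h2 := ler_wpM2r E0 sp.
have h3 : Num.sqrt d%:R * (W / 16) <= 1 / 2 * Esqrt.
  by apply: le_trans h2; rewrite [_ p * _]mulrC -mulrA.
rewrite mulrA in h3; lra.
Qed.

(** The windows [d 4^k, d 4^(k+1)) add up geometrically: the factor sqrt d of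
    the bound doubles from each one to the next. *)
Lemma high_degree d : (0 < d)%N ->
  Num.sqrt d%:R * \sum_(S : {set 'I_n} | (d <= #|S|)%N) a S ^+ 2 <= 16 * Esqrt.
Proof.
have [k] := ubnP (n.+1 - d); elim: k d => // k IH d + d0.
rewrite ltnS => nd; have [nd'|dn] := ltnP n d.
  rewrite big_pred0 ?mulr0 ?mulr_ge0 ?expect_sqrt_ge0 // => S.
  apply/negbTE; rewrite -ltnNge; apply: leq_ltn_trans nd'.
  by rewrite -[X in (_ <= X)%N]card_ord max_card.
have d4 : (0 < 4 * d)%N by rewrite muln_gt0.
have /IH/(_ d4) hi : (n.+1 - 4 * d < k)%N by lia.
have lo := window_weight d0.
have -> : \sum_(S : {set 'I_n} | (d <= #|S|)%N) a S ^+ 2 =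
   \sum_(S : {set 'I_n} | (d <= #|S| < 4 * d)%N) a S ^+ 2
   + \sum_(S : {set 'I_n} | (4 * d <= #|S|)%N) a S ^+ 2.
  rewrite (bigID (fun S : {set 'I_n} => (#|S| < 4 * d)%N)) /=; congr (_ + _).
  by apply: eq_bigl => S; rewrite -leqNgt; lia.
have s4 : Num.sqrt (4 * d)%:R = 2 * Num.sqrt d%:R :> R.
  rewrite natrM sqrtrM //; congr (_ * _).
  rewrite (_ : 4 = 2 ^+ 2); last by rewrite -natrX.
  by rewrite sqrtr_sqr ger0_norm.
rewrite s4 -mulrA in hi; rewrite mulrDr; lra.
Qed.

End HighDegree.

(** * Hypercontractivity *)

Section Hypercontractivity.
Variables (R : realType) (n : nat).
Implicit Types (S T : {set 'I_n}) (x y : cube n) (b : {set 'I_n} -> R).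

Lemma big_subset_setD1 (i : 'I_n) T (g : {set 'I_n} -> R) : i \in T ->
  \sum_(S : {set 'I_n} | S \subset T) g S =
  \sum_(S : {set 'I_n} | S \subset T :\ i) g S +
  \sum_(S : {set 'I_n} | S \subset T :\ i) g (i |: S).
Proof.
move=> iT; rewrite (bigID (fun S : {set 'I_n} => i \in S)) /= addrC; congr (_ + _).
  by apply: eq_bigl => S; rewrite subsetD1.
rewrite (reindex_onto (fun S => i |: S) (fun S => S :\ i)) /=; last first.
  by move=> S /andP[_ iS]; rewrite setD1K.
apply: eq_bigl => S; rewrite subUset sub1set iT setU11 andbT /= subsetD1.
apply: andb_id2l => _; apply/eqP/idP => [<-|iS]; first by rewrite setD11.
by rewrite setU1K.
Qed.

(** Bonami's inequality, by induction on T. Writing the sum as P + x_i Q with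
    P and Q free of x_i, the odd powers of x_i vanish in mean, and
    E (P + x_i Q)^4 = E P^4 + 6 E P^2 Q^2 + E Q^4 <= (N P + 3 N Q)^2. *)
Lemma bonami T b :
  expect (fun y => (\sum_(S : {set 'I_n} | S \subset T) b S * chi R S y) ^+ 4) <=
  (\sum_(S : {set 'I_n} | S \subset T) 3 ^+ #|S| * b S ^+ 2) ^+ 2.
Proof.
have [k] := ubnP #|T|; elim: k T b => // k IH T b Tk.
have [->|[i iT]] := set_0Vmem T.
  under eq_bigl do rewrite subset0.
  under eq_expect do
    (under eq_bigl do rewrite subset0; rewrite big_pred1_eq chi0 mulr1).
  by rewrite big_pred1_eq expect_cst cards0 expr0 mul1r -exprM.
pose P y := \sum_(S : {set 'I_n} | S \subset T :\ i) b S * chi R S y.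
pose Q y := \sum_(S : {set 'I_n} | S \subset T :\ i) b (i |: S) * chi R S y.
pose nP := \sum_(S : {set 'I_n} | S \subset T :\ i) 3 ^+ #|S| * b S ^+ 2.
pose nQ := \sum_(S : {set 'I_n} | S \subset T :\ i) 3 ^+ #|S| * b (i |: S) ^+ 2.
have T'k : (#|T :\ i| < k)%N by rewrite (cardsD1 i T) iT in Tk.
have hP : expect (fun y => P y ^+ 4) <= nP ^+ 2 by apply: IH.
have hQ : expect (fun y => Q y ^+ 4) <= nQ ^+ 2.
  exact: (IH _ (fun S => b (i |: S))).
have nP0 : 0 <= nP by apply: sumr_ge0 => S _; rewrite mulr_ge0 ?sqr_ge0 ?exprn_ge0.
have nQ0 : 0 <= nQ by apply: sumr_ge0 => S _; rewrite mulr_ge0 ?sqr_ge0 ?exprn_ge0.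
have -> : \sum_(S : {set 'I_n} | S \subset T) 3 ^+ #|S| * b S ^+ 2 = nP + 3 * nQ.
  rewrite (big_subset_setD1 _ iT); congr (_ + _); rewrite mulr_sumr.
  apply: eq_bigr => S; rewrite subsetD1 => /andP[_ iS].
  by rewrite cardsU1 iS add1n exprS mulrA.
have sumE y : \sum_(S : {set 'I_n} | S \subset T) b S * chi R S y =
    P y + signR R (y i) * Q y.
  rewrite (big_subset_setD1 _ iT); congr (_ + _); rewrite mulr_sumr.
  apply: eq_bigr => S; rewrite subsetD1 => /andP[_ iS].
  rewrite mulrCA; congr (_ * _).
  rewrite /chi (big_setD1 i) ?setU11 //= setU1K //.
have chi_flip_notin S y : S \subset T :\ i -> chi R S (flip y i) = chi R S y.
  by rewrite subsetD1 chi_flip => /andP[_ /negbTE->]; rewrite mul1r.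
have Pflip y : P (flip y i) = P y by apply: eq_bigr => S /chi_flip_notin->.
have Qflip y : Q (flip y i) = Q y by apply: eq_bigr => S /chi_flip_notin->.
have -> : expect (fun y => (\sum_(S : {set 'I_n} | S \subset T) b S * chi R S y) ^+ 4) =
    expect (fun y => P y ^+ 4) + 6 * expect (fun y => P y ^+ 2 * Q y ^+ 2)
    + expect (fun y => Q y ^+ 4).
  have odd0 : expect (fun y => signR R (y i) *
      (4 * P y ^+ 3 * Q y + 4 * P y * Q y ^+ 3)) = 0.
    apply: (@expect_odd _ _ i) => y.
    by rewrite Pflip Qflip ffunE eqxx signR_neg mulNr.
  rewrite -[RHS]addr0 -[X in _ = _ + X]odd0 -expectZ -!expectD.
  apply: eq_expect => y.
  rewrite sumE; have := signRM R (y i); set s := signR R (y i) => s1.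
  have -> : (P y + s * Q y) ^+ 4 = P y ^+ 4 + 6 * (P y ^+ 2 * Q y ^+ 2) * (s * s)
     + Q y ^+ 4 * (s * s) * (s * s) +
     s * (4 * P y ^+ 3 * Q y + 4 * P y * Q y ^+ 3 * (s * s)) by ring.
  by rewrite s1 !mulr1.
have hPQ : expect (fun y => P y ^+ 2 * Q y ^+ 2) <= nP * nQ.
  rewrite -ler_sqr ?nnegrE ?mulr_ge0 //; last first.
    by apply: expect_ge0 => y; rewrite mulr_ge0 ?sqr_ge0.
  apply: le_trans (expect_CS _ _) _; rewrite exprMn.
  under eq_expect do rewrite -exprM.
  under [X in _ * X]eq_expect do rewrite -exprM.
  by apply: ler_pM => //; apply: expect_ge0 => y; rewrite (exprM _ 2 2) sqr_ge0.
have -> : (nP + 3 * nQ) ^+ 2 = nP ^+ 2 + 6 * (nP * nQ) + nQ ^+ 2 + 8 * nQ ^+ 2.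
  by ring.
have := sqr_ge0 nQ; lra.
Qed.

(** Polynomials of degree at most D have comparable L2 and L4 norms. *)
Lemma bonami_deg (P : pred {set 'I_n}) b D :
  (forall S, P S -> (#|S| <= D)%N) ->
  expect (fun y => (\sum_(S | P S) b S * chi R S y) ^+ 4) <=
  9 ^+ D * (\sum_(S | P S) b S ^+ 2) ^+ 2.
Proof.
move=> PD; pose b' S := if P S then b S else 0.
have := bonami setT b'.
under eq_bigl do rewrite subsetT.
rewrite (_ : expect _ =
  expect (fun y => (\sum_(S | P S) b S * chi R S y) ^+ 4)); last first.
  apply: eq_expect => y; congr (_ ^+ 4); rewrite [RHS]big_mkcond; apply: eq_big.
    by move=> S; rewrite subsetT.
  by move=> S _; rewrite /b'; case: ifP; rewrite ?mul0r.
move=> /le_trans; apply.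
have -> : 9 ^+ D = (3 ^+ D) ^+ 2 :> R by rewrite exprAC -[3 ^+ 2]natrX.
rewrite -exprMn ler_sqr ?nnegrE; last 2 first.
- by apply: sumr_ge0 => S _; rewrite mulr_ge0 ?sqr_ge0 ?exprn_ge0.
- by rewrite mulr_ge0 ?exprn_ge0 ?sumr_ge0 // => S _; apply: sqr_ge0.
rewrite mulr_sumr [leRHS]big_mkcond; apply: ler_sum => S _.
rewrite /b'; case: ifP => [/PD SD|_]; last by rewrite expr0n mulr0.
by rewrite ler_wpM2r ?sqr_ge0 // ler_weXn2l // ler1n.
Qed.

End Hypercontractivity.

(** * Low-degree weight *)

Section LowDegree.
Variables (R : realType) (n : nat) (f : cube n -> sign).
Implicit Types (S T J : {set 'I_n}) (x y : cube n) (D : nat).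

Local Notation F := (fun y : cube n => signR R (f y)).
Local Notation a := (fourier F).
Local Notation V := (variance F).
Local Notation M := (\sum_(i < n) influence R f i ^+ 2).
Local Notation Esqrt := (expect (fun y => Num.sqrt ((sensitivity f y)%:R : R))).

Definition low_weight D : R := \sum_(S : {set 'I_n} | (0 < #|S| <= D)%N) a S ^+ 2.

Lemma low_weight_ge0 D : 0 <= low_weight D.
Proof. by apply: sumr_ge0 => S _; apply: sqr_ge0. Qed.

Lemma variance_ge0 : 0 <= V.
Proof. by rewrite variance_fourier sumr_ge0 // => S _; apply: sqr_ge0. Qed.

(** Some Z = F - c with c = 1 or c = -1 takes its values in {0, 2, -2} and has
    E Z^2 <= 2 V. As Z = Z (Z^2 / 4), two applications of Cauchy-Schwarz to
    q = E Z l, with l the part of F of degrees 1 to D, put all of the support of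
    Z against the fourth moment of l, which is at most 9^D q^2 by Bonami. *)
Lemma low_weight_variance D : low_weight D ^+ 2 <= 2 * 9 ^+ D * V ^+ 3.
Proof.
set q := low_weight D.
have q0 : 0 <= q := low_weight_ge0 D.
pose l y := \sum_(S : {set 'I_n} | (0 < #|S| <= D)%N) a S * chi R S y.
pose m := expect F.
have VE : V = 1 - m ^+ 2.
  rewrite varianceE -/m; congr (_ - _).
  by under eq_expect do rewrite signR_sqr; rewrite expect_cst.
pose c : R := signR R (m < 0).
have c2 : c ^+ 2 = 1 by apply: signR_sqr.
have cm : c * m = `|m|.
  rewrite /c /signR; case: ltP => m0; first by rewrite expr1 mulN1r ltr0_norm.
  by rewrite expr0 mul1r ger0_norm.
pose Z y := signR R (f y) - c.
pose z := expect (fun y => Z y ^+ 2).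
have Z4 y : Z y ^+ 2 * Z y ^+ 2 = 4 * Z y ^+ 2.
  rewrite /Z /c /signR.
  by case: (f y); case: (m < 0); rewrite /= ?expr1 ?expr0; ring.
have z0 : 0 <= z by apply: expect_ge0 => y; apply: sqr_ge0.
have zV : z <= 2 * V.
  have -> : z = 2 - 2 * `|m|.
    rewrite -cm /z; transitivity (expect (fun y => 2 + (- 2 * c) * signR R (f y))).
      by apply: eq_expect => y; rewrite /Z sqrrB signR_sqr c2; ring.
    by rewrite expectD expectZ expect_cst -/m; ring.
  have V0 := variance_ge0.
  rewrite VE -(real_normK (num_real m)); set t := `|m|.
  have t0 : 0 <= t by apply: normr_ge0.
  have : t <= 1.
    by rewrite -(expr_le1 (ltn0Sn 1)) // real_normK ?num_real // -subr_ge0 -VE.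
  nra.
have qZ : q = expect (fun y => Z y * (Z y ^+ 2 / 4 * l y)).
  transitivity (expect (fun y => signR R (f y) * l y)).
    by rewrite expectM_chi_sum; apply: eq_bigr => S _; rewrite expr2.
  have l0 : expect l = 0.
    rewrite expect_sum big1 // => S /andP[S0 _].
    by rewrite expectZ expect_chi -cards_eq0 (gtn_eqF S0) mulr0.
  rewrite -[LHS]subr0 -[X in _ - X](mulr0 c) -l0 -expectZ -expectB.
  apply: eq_expect => y; rewrite -mulrBl -/(Z y) mulrA; congr (_ * _).
  rewrite /Z /c /signR.
  by case: (f y); case: (m < 0); rewrite /= ?expr1 ?expr0; field.
pose Y := expect (fun y => Z y ^+ 2 * l y ^+ 2).
have Y0 : 0 <= Y by apply: expect_ge0 => y; rewrite mulr_ge0 ?sqr_ge0.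
have qY : q ^+ 2 <= z * (Y / 4).
  rewrite qZ; apply: le_trans (expect_CS _ _) _; rewrite le_eqVlt; apply/orP; left.
  apply/eqP; congr (_ * _); rewrite /Y -expectZr; apply: eq_expect => y.
  have -> : (Z y ^+ 2 / 4 * l y) ^+ 2 = (Z y ^+ 2 * Z y ^+ 2) * l y ^+ 2 / 16 by field.
  by rewrite Z4; field.
have YB : Y ^+ 2 <= 4 * z * (9 ^+ D * q ^+ 2).
  apply: le_trans (expect_CS _ _) _; apply: ler_pM.
  - by apply: expect_ge0 => y; apply: sqr_ge0.
  - by apply: expect_ge0 => y; apply: sqr_ge0.
  - by rewrite -expectZ; apply: ler_expect => y; rewrite expr2 Z4.
  under eq_expect do rewrite -exprM.
  by apply: bonami_deg => S /andP[].
have [->|qn0] := eqVneq q 0.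
  by rewrite expr0n mulr_ge0 ?mulr_ge0 ?exprn_ge0 // variance_ge0.
have q2 : 0 < q ^+ 2 by rewrite exprn_gt0 // lt_def qn0.
have B0 : 0 <= 9 ^+ D :> R by rewrite exprn_ge0.
apply: (@le_trans _ _ (9 ^+ D / 4 * z ^+ 3)).
  rewrite -(ler_pM2r q2).
  apply: (@le_trans _ _ ((z * (Y / 4)) ^+ 2)).
    by rewrite -[q ^+ 2 * _]expr2 ler_sqr ?nnegrE ?sqr_ge0 // mulr_ge0 ?divr_ge0.
  have -> : (z * (Y / 4)) ^+ 2 = z ^+ 2 / 16 * Y ^+ 2 by field.
  have -> : 9 ^+ D / 4 * z ^+ 3 * q ^+ 2 = z ^+ 2 / 16 * (4 * z * (9 ^+ D * q ^+ 2)).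
    by field.
  by rewrite ler_wpM2l // divr_ge0 ?sqr_ge0.
have -> : 2 * 9 ^+ D * V ^+ 3 = 9 ^+ D / 4 * (2 * V) ^+ 3 by field.
rewrite ler_wpM2l ?divr_ge0 // lerXn2r ?nnegrE //.
by rewrite mulr_ge0 // variance_ge0.
Qed.

(** The weight b_j of the sets S of size at most D that meet J in j alone is
    E U_j G_j, where U_j = y_j u_j and G_j is its part of degree at most D. The
    U_j are small in L1 by the influences, and jointly small in L2 by Bessel;
    the tails of G_j are light by Bonami's inequality. Cutting |G_j| at T, that is
    |G_j| <= T + G_j^2 / T, gives
      b_j <= T E |U_j| + E |U_j| G_j^2 / T,
    and with T = sqrt (s b_j) each of the two terms is bounded by a part of b_j
    that the left side absorbs, plus s Inf_j^2 or (9^D / s) E U_j^2. *)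
Lemma unit_weight_influence J D (s : R) : 0 < s ->
  unit_weight J (fun S => if (#|S| <= D)%N then a S ^+ 2 else 0) <=
  2 * s * M + 2 * 9 ^+ D / s.
Proof.
move=> s0.
pose U j y := signR R (y j) * rcoef J F j y.
pose P j (S : {set 'I_n}) := (S :&: J == [set j]) && (#|S| <= D)%N.
pose G j y := \sum_(S | P j S) a S * chi R S y.
pose b j := \sum_(S | P j S) a S ^+ 2.
have B0 : 0 < 9 ^+ D :> R by rewrite exprn_gt0.
have -> : unit_weight J (fun S => if (#|S| <= D)%N then a S ^+ 2 else 0) =
    \sum_(j in J) b j.
  by apply: eq_bigr => j _; rewrite /b /P big_mkcondr.
have bj j : j \in J ->
    b j / 2 <= s * influence R f j ^+ 2 + 9 ^+ D / s * expect (fun y => U j y ^+ 2).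
  move=> jJ; set I := influence R f j; set e2 := expect _.
  have e20 : 0 <= e2 by apply: expect_ge0 => y; apply: sqr_ge0.
  have b0 : 0 <= b j by apply: sumr_ge0 => S _; apply: sqr_ge0.
  have [->|bn0] := eqVneq (b j) 0.
    rewrite mul0r addr_ge0 // mulr_ge0 ?sqr_ge0 ?(ltW s0) // divr_ge0 //; exact: ltW.
  have bp : 0 < b j by rewrite lt_def bn0.
  have bE : b j = expect (fun y => U j y * G j y).
    under eq_expect do rewrite /U chi_rcoef //.
    rewrite expect_chi_sumM; apply: eq_big => S; rewrite ?expr2 // /P.
    by rewrite andbA andbb.
  have G4 : expect (fun y => G j y ^+ 4) <= 9 ^+ D * b j ^+ 2.
    by apply: bonami_deg => S /andP[].
  have UI : expect (fun y => `|U j y|) <= I.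
    apply: le_trans (rcoef_L1 R f jJ); apply: ler_expect => y.
    by rewrite normrM /signR normr_sign mul1r.
  pose T := Num.sqrt (s * b j).
  have T0 : 0 < T by rewrite sqrtr_gt0 mulr_gt0.
  have TE : T ^+ 2 = s * b j by rewrite sqr_sqrtr // ltW // mulr_gt0.
  have main : b j <= T * expect (fun y => `|U j y|) + 9 ^+ D / s * e2 +
      (4 * 9 ^+ D * b j)^-1 * expect (fun y => G j y ^+ 4).
    rewrite {1}bE -!expectZ -!expectD; apply: ler_expect => y.
    apply: le_trans (ler_norm _) _; rewrite normrM.
    rewrite -[U j y ^+ 2]real_normK ?num_real //.
    have -> : G j y ^+ 4 = `|G j y| ^+ 4.
      by rewrite -normrX ger0_norm // (exprM _ 2 2) sqr_ge0.
    have v0 : 0 <= `|U j y| by apply: normr_ge0.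
    have g0 : 0 <= `|G j y| by apply: normr_ge0.
    move: v0 g0; set v := `|U j y|; set g := `|G j y| => v0 g0.
    apply: (@le_trans _ _ (T * v + v * (g ^+ 2 / T))).
      have : 0 <= v * ((g - T / 2) ^+ 2 + 3 / 4 * T ^+ 2) / T.
        rewrite divr_ge0 ?(ltW T0) // mulr_ge0 // addr_ge0 ?sqr_ge0 //.
        by rewrite mulr_ge0 ?sqr_ge0 //; lra.
      have -> : v * ((g - T / 2) ^+ 2 + 3 / 4 * T ^+ 2) / T =
         T * v + v * (g ^+ 2 / T) - v * g by field; rewrite gt_eqF.
      by rewrite subr_ge0.
    rewrite -addrA lerD2l -subr_ge0.
    set B : R := 9 ^+ D in B0 *.
    have -> : B / s * v ^+ 2 + (4 * B * b j)^-1 * g ^+ 4 - v * (g ^+ 2 / T) =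
      B / s * (v - s * g ^+ 2 / (2 * B * T)) ^+ 2
      + g ^+ 4 / (4 * B) * ((b j)^-1 - s / T ^+ 2).
      by field; rewrite !gt_eqF.
    rewrite TE; have -> : (b j)^-1 - s / (s * b j) = 0 by field; rewrite !gt_eqF.
    by rewrite mulr0 addr0 mulr_ge0 ?sqr_ge0 // divr_ge0 // ltW.
  have h1 : T * expect (fun y => `|U j y|) <= s * I ^+ 2 + b j / 4.
    apply: (@le_trans _ _ (T * I)); first by rewrite ler_wpM2l // ltW.
    have : 0 <= (s * I - T / 2) ^+ 2 / s by rewrite divr_ge0 ?sqr_ge0 // ltW.
    have -> : (s * I - T / 2) ^+ 2 / s = s * I ^+ 2 + T ^+ 2 / s / 4 - T * I.
      by field; rewrite gt_eqF.
    have -> : T ^+ 2 / s = b j by rewrite TE; field; rewrite gt_eqF.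
    by rewrite subr_ge0.
  have h2 : (4 * 9 ^+ D * b j)^-1 * expect (fun y => G j y ^+ 4) <= b j / 4.
    have c0 : 0 < 4 * 9 ^+ D * b j by rewrite !mulr_gt0.
    rewrite mulrC ler_pdivrMr //; apply: le_trans G4 _.
    by rewrite le_eqVlt; apply/orP; left; apply/eqP; field.
  lra.
have half : (\sum_(j in J) b j) / 2 <= s * M + 9 ^+ D / s.
  apply: (@le_trans _ _ (\sum_(j in J) (s * influence R f j ^+ 2 +
      9 ^+ D / s * expect (fun y => U j y ^+ 2)))).
    by rewrite mulr_suml; apply: ler_sum.
  rewrite big_split -!mulr_sumr /=; apply: lerD.
    rewrite ler_wpM2l ?(ltW s0) // [leLHS]big_mkcond; apply: ler_sum => j _.
    by case: ifP => // _; apply: sqr_ge0.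
  rewrite -[leRHS]mulr1 ler_wpM2l ?divr_ge0 ?(ltW s0) ?(ltW B0) //.
  rewrite -expect_sum -[leRHS](@expect_cst R n); apply: ler_expect => y.
  rewrite (eq_bigr (fun j => rcoef J F j y ^+ 2)) => [|j _].
    by apply: rcoef_bessel => x; apply: signR_sqr.
  by rewrite /U exprMn signR_sqr mul1r.
have -> : 2 * s * M + 2 * 9 ^+ D / s = 2 * (s * M + 9 ^+ D / s) by ring.
lra.
Qed.

(** A uniformly random J meets S in exactly one point with probability
    |S| / 2^|S|, which is at least 2^-D if 0 < |S| <= D. *)
Lemma low_weight_influence D (s : R) : 0 < s ->
  low_weight D <= 2 ^+ D * (2 * s * M + 2 * 9 ^+ D / s).
Proof.
move=> s0; set B := _ + _.
have p01 : 0 <= (1 / 2 : R) <= 1 by lra.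
pose w (S : {set 'I_n}) := if (#|S| <= D)%N then a S ^+ 2 else 0.
have wB : \sum_S w S * (#|S|%:R * (1 / 2 * (1 - 1 / 2) ^+ #|S|.-1)) <= B.
  apply: (@le_trans _ _ ((\sum_(J : {set 'I_n}) rset_prob (1 / 2) J) * B)); last first.
    by rewrite rset_prob_sum1 mul1r.
  rewrite -rset_unit_weight mulr_suml.
  by apply: ler_sum => J _; rewrite ler_wpM2l ?rset_prob_ge0 ?unit_weight_influence.
apply: (@le_trans _ _ (2 ^+ D *
    \sum_S w S * (#|S|%:R * (1 / 2 * (1 - 1 / 2) ^+ #|S|.-1)))); last first.
  by rewrite ler_wpM2l // exprn_ge0.
rewrite mulr_sumr /low_weight big_mkcond; apply: ler_sum => S _.
have hE : 1 - 1 / 2 = 2^-1 :> R by field.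
rewrite hE /w; case: ifP => [/andP[S0 SD]|]; last first.
  move=> _; case: ifP => _; last by rewrite mul0r mulr0.
  rewrite mulr_ge0 ?exprn_ge0 // mulr_ge0 ?sqr_ge0 // mulr_ge0 //.
  rewrite mulr_ge0 ?exprn_ge0 //.
    lra.
  by rewrite invr_ge0.
rewrite SD mulrCA -[leLHS]mulr1 ler_wpM2l ?sqr_ge0 //.
have -> : 1 / 2 * 2^-1 ^+ #|S|.-1 = (2 ^+ #|S|)^-1 :> R.
  by rewrite mul1r -exprS prednK // exprVn.
rewrite mulrCA -[leLHS]mul1r; apply: ler_pM => //; first by rewrite ler1n.
by rewrite ler_pdivlMr ?exprn_gt0 // mul1r ler_weXn2l // ler1n.
Qed.

(** The bound by the variance is used if 8 * 9^D V <= 1, and the bound by the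
    influences otherwise. *)
Lemma low_weight_half D : M * 4096 ^+ D.+1 <= 1 -> low_weight D <= V / 2.
Proof.
move=> hM; have V0 := variance_ge0; have q0 := low_weight_ge0 D.
have N0 : 0 < 9 ^+ D :> R by rewrite exprn_gt0.
have M0 : 0 <= M by apply: sumr_ge0 => i _; apply: sqr_ge0.
have [V9|V9] := leP (8 * 9 ^+ D * V) 1.
  rewrite -ler_sqr ?nnegrE ?divr_ge0 //.
  apply: le_trans (low_weight_variance D) _.
  have -> : 2 * 9 ^+ D * V ^+ 3 = (V / 2) ^+ 2 * (8 * 9 ^+ D * V) by field.
  by rewrite -[leRHS]mulr1 ler_wpM2l ?sqr_ge0.
(* this s makes the term 2^D * 2 * 9^D / s equal to 1 / (32 * 9^D), a quarter of
   the lower bound that V > 1 / (8 * 9^D) gives for V *)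
pose s : R := 64 * 2 ^+ D * 81 ^+ D.
have t0 : 0 < 2 ^+ D :> R by rewrite exprn_gt0.
have s0 : 0 < s by rewrite !mulr_gt0 ?exprn_gt0.
apply: le_trans (low_weight_influence D s0) _.
have e81 : 81 ^+ D = 9 ^+ D * 9 ^+ D :> R by rewrite -exprMn -natrM.
have -> : 2 ^+ D * (2 * s * M + 2 * 9 ^+ D / s) =
    (4096 * (2 * 2 * 81 * 9) ^+ D * M + 1) / (32 * 9 ^+ D).
  by rewrite /s !exprMn e81; field; rewrite !gt_eqF.
have le1 : 4096 * (2 * 2 * 81 * 9) ^+ D * M <= 1.
  apply: le_trans hM; rewrite [M * _]mulrC exprS ler_wpM2r // ler_wpM2l //.
  by rewrite lerXn2r ?nnegrE ?mulr_ge0 //; lra.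
rewrite ler_pdivrMr ?mulr_gt0 //.
have -> : V / 2 * (32 * 9 ^+ D) = 2 * (8 * 9 ^+ D * V) by field.
lra.
Qed.

Lemma variance_split D :
  V = low_weight D + \sum_(S : {set 'I_n} | (D.+1 <= #|S|)%N) a S ^+ 2.
Proof.
rewrite variance_fourier /low_weight (bigID (fun S : {set 'I_n} => (#|S| <= D)%N)) /=.
congr (_ + _); apply: eq_bigl => S; rewrite -card_gt0 -?ltnNge //.
by case: #|S|.
Qed.

Lemma expect_sqrt_variance : V <= 16 * Esqrt.
Proof.
rewrite (variance_split 0); have := high_degree R f (ltn0Sn 0).
rewrite sqrtr1 mul1r; have -> : low_weight 0 = 0; last by rewrite add0r.
by rewrite /low_weight big_pred0 // => S; case: #|S|.
Qed.

Lemma expect_sqrt_influence D : M * 4096 ^+ D.+1 <= 1 ->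
  Num.sqrt D.+1%:R * V <= 32 * Esqrt.
Proof.
move=> /low_weight_half low; have := high_degree R f (ltn0Sn D).
set W := \sum_(S | _) _ => hi.
have VW : V / 2 <= W by have := variance_split D; rewrite -/W; lra.
have := ler_wpM2l (sqrtr_ge0 (D.+1%:R : R)) VW; lra.
Qed.

End LowDegree.

Section Logarithm.
Variable R : realType.

Lemma expR1_le4 : expR 1 <= 4 :> R.
Proof.
have h : (1 / 2 : R) <= expR (- (1 / 2)).
  by apply: le_trans (expR_ge1Dx _); lra.
have p : 0 < expR (1 / 2) :> R := expR_gt0 _.
have h2 : expR (1 / 2) <= 2 :> R.
  have := ler_wpM2l (ltW p) h; rewrite expRN divff ?gt_eqF //; lra.
have -> : expR 1 = expR (1 / 2) * expR (1 / 2) :> R.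
  by rewrite -expRD; congr expR; field.
nra.
Qed.

Lemma sqrt_ln_le (M : R) (K : nat) : 0 < M -> 1 < M * 4096 ^+ K ->
  Num.sqrt (ln (2 + expR 1 / M)) <= 64 * Num.sqrt K.+1%:R.
Proof.
move=> M0 hM; have e4 := expR1_le4.
have e0 : 0 < expR 1 :> R := expR_gt0 _.
have A0 : 1 <= 4096 ^+ K :> R by rewrite exprn_ege1 // ler1n.
have arg : 2 + expR 1 / M <= 4096 ^+ K.+1.
  have : expR 1 / M <= 4 * 4096 ^+ K.
    by rewrite ler_pdivrMr //; nra.
  rewrite exprS; lra.
have arg0 : 0 < 2 + expR 1 / M by rewrite addr_gt0 // divr_gt0.
have lnle : ln (2 + expR 1 / M) <= K.+1%:R * 4096.
  apply: (@le_trans _ _ (ln (4096 ^+ K.+1))).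
    by rewrite ler_ln ?posrE ?exprn_gt0.
  rewrite lnXn // -[ln _ *+ _]mulr_natl ler_wpM2l //.
  have -> : 4096 = 1 + 4095 :> R by ring.
  by apply: le_trans (le_ln1Dx _) _; lra.
apply: (@le_trans _ _ (Num.sqrt (K.+1%:R * 4096))).
  by apply: ler_wsqrtr.
rewrite sqrtrM // mulrC ler_wpM2r ?sqrtr_ge0 //.
rewrite (_ : 4096 = 64 ^+ 2); last by rewrite -natrX.
by rewrite sqrtr_sqr ger0_norm.
Qed.

End Logarithm.

(** * The inequality *)

Theorem theorem3 (R : realType) :
  exists C : R, 0 < C /\
    forall (n : nat) (f : cube n -> sign),
      (1 <= n)%N ->
      ~ (exists c : sign, forall y : cube n, f y = c) ->
      expect (fun y => Num.sqrt (sensitivity f y)%:R) >=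
        C * variance (fun y => signR R (f y)) *
        Num.sqrt (ln (2 + expR 1 / \sum_(i < n) influence R f i ^+ 2)).
Proof.
exists (4096^-1); split=> [|n f _ _]; first by rewrite invr_gt0.
set E := expect _; set V := variance _; set M := \sum_(i < n) _.
have V0 : 0 <= V := variance_ge0 R f.
have VE : V <= 16 * E := expect_sqrt_variance R f.
have E0 : 0 <= E by lra.
have reduce (t : R) : Num.sqrt (ln (2 + expR 1 / M)) <= t -> V * t <= 4096 * E ->
    4096^-1 * V * Num.sqrt (ln (2 + expR 1 / M)) <= E.
  move=> ht hV; rewrite -mulrA mulrC ler_pdivrMr // [E * _]mulrC.
  by apply: le_trans hV; rewrite ler_wpM2l.
have : 0 <= M by apply: sumr_ge0 => i _; apply: sqr_ge0.
rewrite le_eqVlt => /predU1P[M0|M0].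
  apply: (reduce 1); last by lra.
  rewrite -M0 invr0 mulr0 addr0 -[leRHS]sqrtr1 ler_wsqrtr //.
  by apply: le_trans (le_ln1Dx _) _; lra.
have exK : exists K, 1 < M * 4096 ^+ K.
  exists (Num.bound M^-1).
  rewrite -ltr_pdivrMl // mulr1; apply: lt_trans (archi_boundP _) _.
    by rewrite invr_ge0 ltW.
  by rewrite -natrX ltr_nat ltn_expl.
(* D + 1 is the largest exponent to which the low-degree estimate applies; if
   there is none, the logarithm is bounded *)
case: (ex_minnP exK) => K hK minK.
have LK := sqrt_ln_le M0 hK; apply: (reduce _ LK).
have [K1|K1] := leqP K 1.
  have : Num.sqrt K.+1%:R <= 2 :> R.
    rewrite (_ : 2 = Num.sqrt (2 ^+ 2)); last by rewrite sqrtr_sqr ger0_norm.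
    by rewrite ler_wsqrtr // -natrX ler_nat (leq_trans _ (isT : (2 <= 2 ^ 2)%N)).
  have := sqrtr_ge0 (K.+1%:R : R); nra.
case: K K1 {LK} hK minK => [|[|D]] // _ hK minK.
have hD : M * 4096 ^+ D.+1 <= 1.
  by rewrite leNgt; apply/negP => /minK; rewrite ltnn.
have main := expect_sqrt_influence hD.
have sD : Num.sqrt D.+3%:R <= 2 * Num.sqrt D.+1%:R :> R.
  have -> : 2 * Num.sqrt D.+1%:R = Num.sqrt (4 * D.+1%:R) :> R.
    rewrite sqrtrM // (_ : 4 = 2 ^+ 2); last by rewrite -natrX.
    by rewrite sqrtr_sqr ger0_norm.
  by rewrite ler_wsqrtr // -natrM ler_nat; clear; lia.
have := ler_wpM2l V0 sD; rewrite -/V -/E in main *; lra.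
Qed.
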